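(* Let $p$ be a prime, $q=p^a$ with $a\ge 1$, and let $f(x)\in\mathbb{F}_q[x]$ have degree $d$ with $\gcd(d,p)=1$. Then for every $\lambda\in\mathbb{F}_p^\times$, \[ \mathrm{NP}(f)=\mathrm{NP}(\lambda f). \]
   Context: Let $\mathbb{Q}_q$ be the unramified extension of $\mathbb{Q}_p$ of degree $a$, with ring of integers $\mathbb{Z}_q$, and fix a primitive $p$-th root of unity $\zeta_p\in\mathbb{C}_p$. For $g(x)=\sum_{i=0}^d b_ix^i\in\mathbb{F}_q[x]$ with $\gcd(\deg g,p)=1$, let $\hat g(x)\in\mathbb{Z}_q[x]$ be obtained by replacing each coefficient by its Teichmüller lift, and for $k\ge1$ set \[ S_g^*(k)=\sum_{x}\zeta_p^{\mathrm{Tr}_{\mathbb{Q}_{q^k}/\mathbb{Q}_p}(\hat g(x))}, \] the sum running over the Teichmüller lifts $x\in\mathbb{Z}_{q^k}^\times$ of the elements of $\mathbb{F}_{q^k}^\times$. Let $L_g^*(s)=\exp\big(\sum_{k\ge1}S_g^*(k)s^k/k\big)$; it is a polynomial $\sum_{n=0}^{\deg g}c_ns^n$ of degree $\deg g$. The Newton polygon $\mathrm{NP}(g)$ is the lower convex hull of the points $(n,\mathrm{ord}_p c_n)$, $0\le n\le \deg g$, where $\mathrm{ord}_p$ is the $p$-adic valuation normalized by $\mathrm{ord}_p(p)=1$. *)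

(* Defs.v *)
From HB Require Import structures.
From mathcomp Require Import all_boot all_order all_algebra.
From mathcomp Require Import boolp classical_sets reals constructive_ereal convex.

Set Implicit Arguments.
Unset Strict Implicit.
Unset Printing Implicit Defensive.
Import Order.TTheory GRing.Theory Num.Theory.

Local Open Scope classical_set_scope.
Local Open Scope ring_scope.

Section PadicFields.
Context {R : realType} {C : closedFieldType} (ord : C -> \bar R).

Definition ord_cvg (u : nat -> C) (l : C) : Prop :=
  forall M : R, exists N : nat, forall n, (N <= n)%N ->
    (M%:E <= ord (u n - l))%E.

Definition ord_cauchy (u : nat -> C) : Prop :=
  forall M : R, exists N : nat, forall m n, (N <= m)%N -> (N <= n)%N ->
    (M%:E <= ord (u m - u n))%E.

(* The topological closure of the rational numbers. When [ord] satisfies      *)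
(* [is_Cp] below, [ord] restricts to the p-adic valuation of the rationals    *)
(* and [C] is complete, so this closure is the field of p-adic numbers.       *)
Definition Qp : set C :=
  [set x | forall M : R, exists r : rat, (M%:E <= ord (x - ratr r))%E].

Definition algebraic_Qp : set C :=
  [set x | exists P : {poly C}, [/\ P != 0, forall i, Qp P`_i & root P x]].

(* These properties characterise the completion of an algebraic closure of    *)
(* the p-adic numbers, together with its valuation, up to isomorphism.        *)
Record is_Cp (p : nat) : Prop := IsCp {
  Cp_ord0 : ord 0 = +oo%E;
  Cp_ord_fin : forall x, x != 0 -> ord x \is a fin_num;
  Cp_ordM : forall x y, ord (x * y) = (ord x + ord y)%E;
  Cp_ordD : forall x y, (Order.min (ord x) (ord y) <= ord (x + y))%E;
  Cp_ord_prime : ord p%:R = 1%:E;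
  Cp_complete : forall u, ord_cauchy u -> exists l, ord_cvg u l;
  Cp_dense : forall (x : C) (M : R),
    exists2 y, algebraic_Qp y & (M%:E <= ord (x - y))%E
}.

Definition is_Qp_basis (K : set C) (n : nat) (e : 'rV[C]_n) : Prop :=
  forall y, K y <->
    exists! c : 'cV[C]_n, (forall i, Qp (c i 0)) /\ y = (e *m c) 0 0.

Definition integers (K : set C) : set C := [set x | K x /\ (0 <= ord x)%E].

(* A finite unramified extension of the p-adic numbers inside [C], with a     *)
(* finite field presented as its residue field through the reduction map.     *)
(* Only the restriction of [ured] to the ring of integers is meaningful.      *)
(* Unramified means that the residue degree equals the degree: the residue    *)
(* field has p ^ udeg elements.                                               *)
Record unram_ext (p : nat) := UnramExt {
  ucarrier : set C;
  udeg : nat;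
  ures : finFieldType;
  ured : C -> ures;
  ucarrier_subfield :
    [/\ ucarrier 1,
        forall x y, ucarrier x -> ucarrier y -> ucarrier (x - y) &
        forall x y, ucarrier x -> ucarrier y -> ucarrier (x / y)];
  ucarrier_Qp : Qp `<=` ucarrier;
  ucarrier_basis : exists e : 'rV[C]_udeg, is_Qp_basis ucarrier e;
  ured1 : ured 1 = 1;
  uredD : forall x y, integers ucarrier x -> integers ucarrier y ->
    ured (x + y) = ured x + ured y;
  uredM : forall x y, integers ucarrier x -> integers ucarrier y ->
    ured (x * y) = ured x * ured y;
  ured_surj : forall b, exists2 x, integers ucarrier x & ured x = b;
  ured_ker : forall x, integers ucarrier x ->
    (ured x = 0 <-> (0 < ord x)%E);
  uunram : #|ures| = (p ^ udeg)%N
}.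

(* The trace of multiplication by [x] on [K], computed in any basis of [K].   *)
Definition trace_Qp (K : set C) (x : C) : C :=
  xget 0 [set t | exists (n : nat) (e : 'rV[C]_n) (M : 'M[C]_n),
    [/\ is_Qp_basis K e, forall i j, Qp (M i j), x *: e = e *m M & t = \tr M]].

Section ExponentialSums.
Context {p : nat}.

Definition teich (E : unram_ext p) (b : ures E) : C :=
  xget 0 [set t | [/\ integers (ucarrier E) t, ured E t = b &
                      t ^+ #|ures E| = t]].

Definition teich_poly (E : unram_ext p) (g : {poly ures E}) : {poly C} :=
  map_poly (teich (E := E)) g.

(* zeta ^ z for zeta ^ p = 1 and z a p-adic integer: zeta ^ n for any natural *)
(* number n congruent to z modulo p.                                          *)
Definition padic_pow (zeta z : C) : C :=
  zeta ^+ xget 0%N [set n : nat | (1%:E <= ord (z - n%:R))%E].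

Variables (zeta : C) (E : nat -> unram_ext p).

Definition expsum (g : {poly ures (E 1%N)}) (k : nat) : C :=
  \sum_(b : ures (E k) | b != 0)
    padic_pow zeta
      (trace_Qp (ucarrier (E k)) (teich_poly g).[teich b]).

(* The coefficient of s ^ n in exp (\sum_(k >= 1) S k / k s ^ k): the terms   *)
(* with k > n, and the powers of exponent j > n, do not contribute.           *)
Definition exp_coef (S : nat -> C) (n : nat) : C :=
  (\sum_(j < n.+1) (j`!%:R)^-1 *:
     (\sum_(1 <= k < n.+1) (S k / k%:R) *: 'X^k) ^+ j)`_n.

Definition Lcoef (g : {poly ures (E 1%N)}) (n : nat) : C :=
  exp_coef (expsum g) n.

Definition plane : Type := convex_lmodType (R^o * R^o)%type.

Definition convex_hull (A : set plane) : set plane :=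
  smallest (@convex_set R _) A.

Definition lower_convex_hull (A : set plane) : set plane :=
  [set P | convex_hull A P /\
           forall y : R, convex_hull A (P.1, y) -> P.2 <= y].

(* Vanishing coefficients, of infinite valuation, contribute no point.        *)
Definition NP (g : {poly ures (E 1%N)}) : set plane :=
  lower_convex_hull
    [set P | exists n : nat, [/\ (n <= (size g).-1)%N, P.1 = n%:R &
                                 ord (Lcoef g n) = (P.2)%:E]].

End ExponentialSums.
End PadicFields.

(* Main.v *)
Require Import Defs.
From HB Require Import structures.
From mathcomp Require Import all_boot all_order all_algebra.
From mathcomp Require Import boolp classical_sets reals constructive_ereal convex.
From mathcomp Require Import ring lra.

(* Let [w] be the Teichmuller representative of [lambda] in Z_p. The lift of  *)
(* [lambda f] is [w] times the lift of [f], and the trace is Q_p-linear, so   *)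
(* the exponential sums of [lambda f] with respect to [zeta] are those of [f] *)
(* with respect to [zeta ^ lambda]. It remains to see that the Newton polygon *)
(* does not depend on the primitive root of unity. The coefficients of the    *)
(* L-function are polynomials in [zeta] with rational coefficients, and [p]   *)
(* is totally ramified in Q(zeta): [\sum_(i < p - 1) a_i (1 - zeta) ^ i] has  *)
(* valuation [min_i (ord a_i + i / (p - 1))], which does not involve [zeta].  *)

Set Implicit Arguments.
Unset Strict Implicit.
Unset Printing Implicit Defensive.
Import Order.TTheory GRing.Theory Num.Theory.
Local Open Scope ring_scope.

(** * Valuations *)

Section Valuation.
Context (R : realFieldType) (F : fieldType) (v : F -> \bar R).

Record is_valuation : Prop := IsValuation {
  valuation0 : v 0 = +oo%E;
  valuation_fin_num : forall x, x != 0 -> v x \is a fin_num;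
  valuationM : forall x y, v (x * y) = (v x + v y)%E;
  valuation_geD_min : forall x y, (Order.min (v x) (v y) <= v (x + y)%R)%E
}.

Definition vcongr (m : \bar R) (x y : F) : bool := (m <= v (x - y)%R)%E.

Context (hv : is_valuation).
Implicit Types (m : \bar R) (x y z : F).

Lemma valuation_EFin x : x != 0 -> exists r : R, v x = r%:E.
Proof. by move=> /(valuation_fin_num hv) /fineK <-; eexists. Qed.

Lemma valuation1 : v 1 = 0%E.
Proof.
have [r v1] := valuation_EFin (oner_neq0 F).
have := valuationM hv 1 1; rewrite mulr1 v1 => -[] ?.
by congr EFin; lra.
Qed.

Lemma valuationX x n : v (x ^+ n) = (v x *+ n)%E.
Proof.
elim: n => [|n IHn]; first by rewrite expr0 valuation1.
by rewrite exprS (valuationM hv) IHn muleS.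
Qed.

Lemma valuation_prod (I : Type) (r : seq I) (P : pred I) (f : I -> F) :
  v (\prod_(i <- r | P i) f i) = (\sum_(i <- r | P i) v (f i))%E.
Proof. exact: (big_morph v (valuationM hv) valuation1). Qed.

Lemma valuation_expr_eq1 x n : (0 < n)%N -> x ^+ n = 1 -> v x = 0%E.
Proof.
move=> n_gt0 xn1; have x_neq0 : x != 0.
  by apply: contra_eq_neq xn1 => ->; rewrite expr0n gtn_eqF // eq_sym oner_eq0.
have [r vx] := valuation_EFin x_neq0; have := valuationX x n.
rewrite xn1 valuation1 vx -EFin_natmul => -[] /esym /eqP.
by rewrite mulrn_eq0 gtn_eqF //= => /eqP ->.
Qed.

Lemma valuationN x : v (- x) = v x.
Proof.
have vN1 : v (-1) = 0%E by apply: (@valuation_expr_eq1 _ 2); rewrite ?sqrrN ?expr1n.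
by rewrite -mulN1r (valuationM hv) vN1 add0e.
Qed.

Lemma valuation_distC x y : v (x - y) = v (y - x).
Proof. by rewrite -valuationN opprB. Qed.

Lemma valuationV x : x != 0 -> v x^-1 = (- v x)%E.
Proof.
move=> x_neq0; have [r vx] := valuation_EFin x_neq0.
have [|s vV] := @valuation_EFin x^-1; first by rewrite invr_eq0.
have := valuationM hv x x^-1; rewrite mulfV // valuation1 vx vV => -[] ?.
by rewrite -EFinN; congr EFin; lra.
Qed.

Lemma valuation_geD m x y : (m <= v x)%E -> (m <= v y)%E -> (m <= v (x + y)%R)%E.
Proof.
by move=> vx vy; apply: le_trans (valuation_geD_min hv x y); rewrite le_min vx vy.
Qed.

Lemma valuation_geB m x y : (m <= v x)%E -> (m <= v y)%E -> (m <= v (x - y)%R)%E.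
Proof. by move=> vx vy; apply: valuation_geD => //; rewrite valuationN. Qed.

Lemma valuation_geMl m x y : (0 <= v x)%E -> (m <= v y)%E -> (m <= v (x * y)%R)%E.
Proof. by move=> vx vy; rewrite (valuationM hv) -[m]add0e leeD. Qed.

Lemma valuation_geMr m x y : (m <= v x)%E -> (0 <= v y)%E -> (m <= v (x * y)%R)%E.
Proof. by rewrite mulrC => vx vy; apply: valuation_geMl. Qed.

Lemma valuation_geX0 x n : (0 <= v x)%E -> (0 <= v (x ^+ n)%R)%E.
Proof.
move=> vx; elim: n => [|n IHn]; first by rewrite expr0 valuation1.
by rewrite exprS valuation_geMl.
Qed.

Lemma valuation_ge_sum m (I : Type) (r : seq I) (P : pred I) (f : I -> F) :
  (forall i, P i -> (m <= v (f i))%E) ->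
  (m <= v (\sum_(i <- r | P i) f i)%R)%E.
Proof.
move=> vf; elim/big_ind: _ => //; last exact: valuation_geD.
by rewrite (valuation0 hv) leey.
Qed.

Lemma valuation_mul_ge x (M : R) : exists N : R, forall y,
  (N%:E <= v y)%E -> (M%:E <= v (x * y)%R)%E.
Proof.
have [->|/valuation_EFin [r vx]] := eqVneq x 0.
  by exists 0 => y _; rewrite mul0r (valuation0 hv) leey.
exists (M - r) => y vy; rewrite (valuationM hv) vx.
by rewrite -[M](subrKC r) EFinD leeD2l.
Qed.

Lemma valuation_natr_ge0 n : (0 <= v n%:R)%E.
Proof.
elim: n => [|n IHn]; first by rewrite (valuation0 hv) le0y.
by rewrite -natr1 valuation_geD ?valuation1.
Qed.

Lemma valuation_ge_eq0 x : (forall M : R, (M%:E <= v x)%E) -> x = 0.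
Proof.
move=> vx; apply/eqP/negPn/negP => /valuation_EFin [r vr].
by have := vx (r + 1); rewrite vr lee_fin; lra.
Qed.

Lemma valuationD_lt x y : (v x < v y)%E -> v (x + y) = v x.
Proof.
move=> lt_xy; apply/eqP; rewrite eq_le; apply/andP; split; last first.
  by rewrite valuation_geD // ltW.
rewrite leNgt; apply/negP => lt_xD.
have := valuation_geD_min hv (x + y) (- y).
by rewrite addrK valuationN leNgt lt_min lt_xD lt_xy.
Qed.

Lemma valuationD_neq x y : v x != v y -> v (x + y) = Order.min (v x) (v y).
Proof.
case: (ltgtP (v x) (v y)) => // [lt_xy|lt_yx] _; first exact: valuationD_lt.
by rewrite addrC; apply: valuationD_lt.
Qed.

Lemma valuation_sum_neq (I : eqType) (r : seq I) (f : I -> F) : uniq r ->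
  {in r &, forall i j, f i != 0 -> v (f i) = v (f j) -> i = j} ->
  v (\sum_(i <- r) f i) = \big[Order.min/+oo%E]_(i <- r) v (f i).
Proof.
elim: r => [|i r IHr] /=; first by rewrite !big_nil (valuation0 hv).
move=> /andP[i_notin_r /IHr {}IHr] inj_f.
have {}IHr : v (\sum_(j <- r) f j) = \big[Order.min/+oo%E]_(j <- r) v (f j).
  by apply: IHr; apply: sub_in2 inj_f => j jr; rewrite inE jr orbT.
rewrite !big_cons -IHr.
have [->|fi_neq0] := eqVneq (f i) 0; first by rewrite add0r (valuation0 hv) minye.
apply: valuationD_neq; apply/eqP => v_eq.
have [v_oo|[j jr vj]] : v (\sum_(j <- r) f j) = +oo%E \/
    exists2 j, j \in r & v (\sum_(j <- r) f j) = v (f j).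
  rewrite IHr big_seq; elim/big_ind: _ => [|x y ? ?|j jr]; first by left.
    by rewrite minEle; case: ifP.
  by right; exists j.
- by have := valuation_fin_num hv fi_neq0; rewrite v_eq v_oo.
move: i_notin_r; rewrite (inj_f i j) ?jr ?mem_head // ?v_eq //.
by rewrite inE jr orbT.
Qed.

Lemma vcongr_refl m x : vcongr m x x.
Proof. by rewrite /vcongr subrr (valuation0 hv) leey. Qed.

Lemma vcongrC m x y : vcongr m x y = vcongr m y x.
Proof. by rewrite /vcongr valuation_distC. Qed.

Lemma vcongr_trans m x y z :
  vcongr m x y -> vcongr m y z -> vcongr m x z.
Proof.
by move=> xy yz; rewrite /vcongr -(subrKA y); apply: valuation_geD.
Qed.

Lemma vcongr_le m (n : \bar R) x y :
  (n <= m)%E -> vcongr m x y -> vcongr n x y.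
Proof. exact: le_trans. Qed.

Lemma vcongr_ge m (n : \bar R) x y :
  (n <= m)%E -> vcongr m x y -> (n <= v y)%E -> (n <= v x)%E.
Proof.
by move=> le_nm xy vy; rewrite -[x](subrK y); apply/valuation_geD/vy/(le_trans le_nm).
Qed.

Lemma vcongrM m x y x' y' : (0 <= v x)%E -> (0 <= v y')%E ->
  vcongr m x x' -> vcongr m y y' -> vcongr m (x * y) (x' * y').
Proof.
move=> x_ge0 y'_ge0 xx' yy'; rewrite /vcongr.
have -> : x * y - x' * y' = x * (y - y') + (x - x') * y' by ring.
by apply: valuation_geD; [apply: valuation_geMl|apply: valuation_geMr].
Qed.

Lemma vcongr_mul2l m x y z : v x = 0%E ->
  vcongr m (x * y) (x * z) = vcongr m y z.
Proof. by move=> vx; rewrite /vcongr -mulrBr (valuationM hv) vx add0e. Qed.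

Lemma vcongrX m x y n : (0 <= v x)%E -> (0 <= v y)%E ->
  vcongr m x y -> vcongr m (x ^+ n) (y ^+ n).
Proof.
move=> x_ge0 y_ge0 xy; elim: n => [|n IHn]; first exact: vcongr_refl.
by rewrite !exprS; apply: vcongrM; rewrite ?valuation_geX0.
Qed.

End Valuation.

(** * Rational numbers in a field of characteristic zero *)

Section RatrPchar0.
Context (F : fieldType).

(* The proof argument allows the ring morphism structure to be inferred.      *)
Definition ratr_pchar0 of [pchar F] =i pred0 : rat -> F := ratr.

Context (F0 : [pchar F] =i pred0).
Local Notation iota := (ratr_pchar0 F0).

Lemma intr_eq0_pchar0 (m : int) : (m%:~R == 0 :> F) = (m == 0).
Proof.
have nat_eq0 := (pcharf0P F).1 F0.
by case: (intP m) => [|n|n]; rewrite ?eqxx // ?mulrNz ?oppr_eq0 -pmulrn nat_eq0.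
Qed.

Lemma ratr_pchar0_frac (m n : int) : n != 0 ->
  iota (m%:~R / n%:~R) = m%:~R / n%:~R.
Proof.
move=> n_neq0; set r := m%:~R / n%:~R.
have : (numq r * n)%:~R = (m * denq r)%:~R :> rat.
  by rewrite !intrM numqE /r mulrAC mulfVK // intr_eq0.
move/intr_inj/(congr1 (intr : int -> F)); rewrite !intrM => numrn.
by apply/eqP; rewrite eqr_div ?intr_eq0_pchar0 ?denq_neq0 //; apply/eqP.
Qed.

Fact ratr_pchar0_is_zmod_morphism : zmod_morphism iota.
Proof.
have subf_div (K : fieldType) (x y z t : K) : y != 0 -> t != 0 ->
    x / y - z / t = (x * t - z * y) / (y * t).
  by move=> y_neq0 t_neq0; rewrite -mulNr addf_div // mulNr.
move=> r s; have -> : r - s =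
    (numq r * denq s - numq s * denq r)%:~R / (denq r * denq s)%:~R.
  rewrite -{1}(divq_num_den r) -{1}(divq_num_den s).
  by rewrite subf_div ?intr_eq0 ?denq_neq0 // !(intrB, intrM).
rewrite ratr_pchar0_frac ?mulf_neq0 ?denq_neq0 // /ratr_pchar0 /ratr.
by rewrite subf_div ?intr_eq0_pchar0 ?denq_neq0 // !(intrB, intrM).
Qed.

Fact ratr_pchar0_is_monoid_morphism : monoid_morphism iota.
Proof.
split=> [|r s]; first by rewrite /ratr_pchar0 /ratr divr1.
have -> : r * s = (numq r * numq s)%:~R / (denq r * denq s)%:~R.
  by rewrite -{1}(divq_num_den r) -{1}(divq_num_den s) mulf_div !intrM.
rewrite ratr_pchar0_frac ?mulf_neq0 ?denq_neq0 // /ratr_pchar0 /ratr.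
by rewrite mulf_div !intrM.
Qed.

HB.instance Definition _ := GRing.isZmodMorphism.Build rat F iota
  ratr_pchar0_is_zmod_morphism.
HB.instance Definition _ := GRing.isMonoidMorphism.Build rat F iota
  ratr_pchar0_is_monoid_morphism.

End RatrPchar0.

Section PadicValuation.
Context (R : realFieldType) (F : fieldType) (v : F -> \bar R) (p : nat).

Record is_padic_valuation : Prop := IsPadicValuation {
  padic_valuation :> is_valuation v;
  padic_prime : prime p;
  valuation_prime : v p%:R = 1%:E
}.

Context (hv : is_padic_valuation).

Lemma valuation_coprime n : coprime n p -> v n%:R = 0%E.
Proof.
move=> co_np; apply/eqP; rewrite eq_le (valuation_natr_ge0 hv) andbT leNgt.
apply/negP => vn_gt0; have n_gt0 : (0 < n)%N.
  rewrite lt0n; apply: contraTneq co_np => ->.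
  by rewrite /coprime gcd0n gtn_eqF ?prime_gt1 ?(padic_prime hv).
have [s t bezout _] := egcdnP p n_gt0.
have : (0 < v (s * n)%:R)%E.
  rewrite natrM (valuationM hv); apply: lt_le_trans vn_gt0 _.
  by rewrite leeDr // (valuation_natr_ge0 hv).
rewrite bezout (eqP co_np) natrD addrC (valuationD_lt hv) (valuation1 hv) ?ltxx //.
rewrite natrM (valuationM hv) (valuation_prime hv).
apply: lt_le_trans (_ : 1%:E <= _)%E; first by rewrite lte_fin ltr01.
by rewrite leeDr ?(valuation_natr_ge0 hv).
Qed.

Lemma valuation_nat n : (0 < n)%N -> v n%:R = (logn p n)%:R%:E.
Proof.
move=> n_gt0; have [m co_pm {1}->] := pfactor_coprime (padic_prime hv) n_gt0.
rewrite natrM (valuationM hv) natrX (valuationX hv) (valuation_prime hv).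
by rewrite valuation_coprime 1?coprime_sym // add0e -EFin_natmul.
Qed.

Lemma padic_pchar0 : [pchar F] =i pred0.
Proof.
apply/pcharf0P => n; have [->|n_gt0] := posnP n; first by rewrite !eqxx.
apply/eqP => n0; have := valuation_nat n_gt0.
by rewrite n0 (valuation0 hv).
Qed.

Lemma valuation_int (m : int) : m != 0 -> v m%:~R = (logn p `|m|)%:R%:E.
Proof.
case: (intP m) => // n _; last rewrite mulrNz (valuationN hv) abszN.
all: by rewrite -pmulrn valuation_nat.
Qed.

Lemma valuation_rat (r : rat) : r != 0 -> exists m : int, v (ratr r) = m%:~R%:E.
Proof.
rewrite -numq_eq0 => num_neq0.
exists ((logn p `|numq r|)%:Z - (logn p `|denq r|)%:Z).
rewrite (valuationM hv) (valuationV hv); last first.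
  by rewrite (intr_eq0_pchar0 padic_pchar0) denq_neq0.
by rewrite !valuation_int ?denq_neq0 // intrB.
Qed.

Lemma valuation_nat_ge k n : (k%:R%:E <= v n%:R)%E = (p ^ k %| n)%N.
Proof.
have [->|n_gt0] := posnP n; first by rewrite (valuation0 hv) leey dvdn0.
by rewrite valuation_nat // lee_fin ler_nat pfactor_dvdn ?(padic_prime hv).
Qed.

Lemma vcongr_nat k m n :
  vcongr v k%:R%:E m%:R n%:R = (m == n %[mod p ^ k]).
Proof.
wlog le_nm : m n / (n <= m)%N => [th_sym|].
  have [/th_sym//|/ltnW/th_sym] := leqP n m.
  by rewrite (vcongrC hv) eq_sym.
by rewrite /vcongr -natrB // valuation_nat_ge eqn_mod_dvd.
Qed.

Lemma vcongr_coprime x l : coprime l p -> vcongr v 1%:E x l%:R -> v x = 0%E.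
Proof.
move=> co_lp xl; have v_l := valuation_coprime co_lp.
rewrite -(subrKC l%:R x) (valuationD_lt hv) v_l //.
by apply: lt_le_trans xl; rewrite lte_fin ltr01.
Qed.

Lemma valuation_subXp_ge m x y : (0 <= v x)%E -> (0 <= v y)%E -> (m <= 1%:E)%E ->
  vcongr v m x y -> (v (x - y)%R + m <= v (x ^+ p - y ^+ p)%R)%E.
Proof.
move=> vx vy m_le1 xy; rewrite subrXX (valuationM hv) leeD2l //.
have -> : \sum_(i < p) x ^+ (p.-1 - i) * y ^+ i =
    \sum_(i < p) (x ^+ (p.-1 - i) - y ^+ (p.-1 - i)) * y ^+ i + p%:R * y ^+ p.-1.
  rewrite mulr_natl -[in X in _ *+ X](card_ord p) -sumr_const -big_split /=.
  apply: eq_bigr => i _; rewrite mulrBl -exprD subnK ?subrK //.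
  by rewrite -ltnS (ltn_predK (ltn_ord i)).
apply: (valuation_geD hv).
  apply: (valuation_ge_sum hv) => i _; apply: (valuation_geMr hv).
    exact: (vcongrX hv).
  exact: (valuation_geX0 hv).
apply: (valuation_geMr hv); last exact: (valuation_geX0 hv).
by rewrite (valuation_prime hv).
Qed.

Lemma valuation_subXpn_ge m x y n : (0 <= v x)%E -> (0 <= v y)%E ->
  (0 <= m)%E -> (m <= 1%:E)%E -> vcongr v m x y ->
  (v (x - y)%R + m *+ n <= v (x ^+ (p ^ n) - y ^+ (p ^ n))%R)%E.
Proof.
move=> vx vy m_ge0 m_le1 xy; elim: n => [|n IHn].
  by rewrite expn0 !expr1 adde0.
rewrite muleS addeCA addeC expnSr !exprM.
apply: le_trans (valuation_subXp_ge _ _ m_le1 _); try exact: (valuation_geX0 hv).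
  exact: leeD2r.
exact: (vcongrX hv).
Qed.

End PadicValuation.

(** * Conjugation in the cyclotomic field *)

Lemma prod_1B_prim_root (F : fieldType) n (z : F) : n.-primitive_root z ->
  \prod_(1 <= i < n) (1 - z ^+ i) = n%:R.
Proof.
move=> prim_z; have := factor_Xn_sub_1 prim_z.
rewrite big_ltn ?(prim_order_gt0 prim_z) // expr0 subrX1.
move/(mulfI (monic_neq0 (monicXsubC _)))/(congr1 (horner^~ 1)).
rewrite horner_prod horner_sum.
under eq_bigr do rewrite hornerXsubC.
move=> ->; under eq_bigr do rewrite hornerXn expr1n.
by rewrite sumr_const card_ord.
Qed.

Lemma prim_root_neq1 (F : fieldType) n (z : F) : (1 < n)%N ->
  n.-primitive_root z -> z != 1.
Proof.
move=> n_gt1 prim_z; rewrite -[z]expr1 -(expr0 z) (eq_prim_root_expr prim_z).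
by rewrite mod0n modn_small.
Qed.

Lemma sum_expr_prim_root (F : fieldType) n (z : F) : (1 < n)%N ->
  n.-primitive_root z -> \sum_(i < n) z ^+ i = 0.
Proof.
move=> n_gt1 prim_z; have /eqP := subrX1 z n.
rewrite (prim_expr_order prim_z) subrr eq_sym mulf_eq0 subr_eq0.
by rewrite (negPf (prim_root_neq1 n_gt1 prim_z)) => /eqP.
Qed.

Lemma horner_modp_prim_root (K F : fieldType) (iota : {rmorphism K -> F}) n (z : F)
    (P : {poly K}) : (1 < n)%N -> n.-primitive_root z ->
  (map_poly iota P).[z] = (map_poly iota (P %% \poly_(i < n) 1)).[z].
Proof.
move=> n_gt1 prim_z; set Phi := \poly_(i < n) 1.
rewrite {1}(divp_eq P Phi) rmorphD rmorphM /= hornerD hornerM.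
suff -> : (map_poly iota Phi).[z] = 0 by rewrite mulr0 add0r.
rewrite (horner_coef_wide _ (_ : _ <= n)%N) ?size_map_poly ?size_poly //.
rewrite -[RHS](sum_expr_prim_root n_gt1 prim_z).
by apply: eq_bigr => i _; rewrite coef_map /= coef_poly ltn_ord rmorph1 mul1r.
Qed.

Section PrimitiveRootValuation.
Context (R : realFieldType) (F : fieldType) (v : F -> \bar R).

Lemma valuation_1B_prim_root_exp (hv : is_valuation v) n (z : F) i :
  n.-primitive_root z -> coprime i n -> v (1 - z ^+ i) = v (1 - z).
Proof.
have le_exp (y : F) j : n.-primitive_root y -> (v (1 - y) <= v (1 - y ^+ j)%R)%E.
  move=> prim_y; have vy : v y = 0%E.
    exact: (valuation_expr_eq1 hv (prim_order_gt0 prim_y) (prim_expr_order prim_y)).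
  have := @vcongrX _ _ _ hv (v (1 - y)) 1 y j.
  by rewrite /vcongr expr1n (valuation1 hv) vy; apply.
move=> prim_z co_in; have prim_zi : n.-primitive_root (z ^+ i).
  by rewrite prim_root_exp_coprime.
have [j zE] := prim_rootP prim_zi (prim_expr_order prim_z).
by apply/le_anti; rewrite {1}[X in (_ <= v (1 - X)%R)%E]zE !le_exp.
Qed.

(* The terms [P`_i * x ^ i] have valuations that are distinct modulo 1.       *)
Lemma valuation_horner_invn (hv : is_valuation v) (P : {poly F}) n (x : F) :
  (0 < n)%N -> (size P <= n)%N -> v x = (n%:R^-1)%:E ->
  (forall i, P`_i != 0 -> exists m : int, v P`_i = m%:~R%:E) ->
  v P.[x] = \big[Order.min/+oo%E]_(i < n) (v P`_i + (i%:R / n%:R)%:E)%E.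
Proof.
move=> n_gt0 size_P vx int_P.
have v_term i : v (P`_i * x ^+ i) = (v P`_i + (i%:R / n%:R)%:E)%E.
  by rewrite (valuationM hv) (valuationX hv) vx -EFin_natmul mulr_natl.
have n_neq0 : n%:R != 0 :> R by rewrite pnatr_eq0 -lt0n.
rewrite (horner_coef_wide _ size_P) (valuation_sum_neq hv) ?index_enum_uniq //.
  by apply: eq_bigr => i _; rewrite v_term.
move=> i j _ _; rewrite mulf_eq0 negb_or => /andP[/int_P [m vPi] _].
rewrite !v_term vPi; have [->|/int_P [l vPj]] := eqVneq P`_j 0.
  by rewrite (valuation0 hv).
rewrite vPj -!EFinD => -[] /(congr1 ( *%R^~ n%:R)).
rewrite !mulrDl !divfK // !pmulrn -!intrM -!intrD => /intr_inj.
move/(congr1 (modz^~ n)); rewrite !modzMDl !modz_nat !modn_small //.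
by move=> [] /val_inj.
Qed.

Context (p : nat) (hv : is_padic_valuation v p).

Lemma valuation_1B_prim_root (z : F) : p.-primitive_root z ->
  v (1 - z) = (p.-1%:R^-1)%:E.
Proof.
move=> prim_z; have p_gt1 := prime_gt1 (padic_prime hv).
have [|r vz] := @valuation_EFin _ _ _ hv (1 - z).
  by rewrite subr_eq0 eq_sym (prim_root_neq1 p_gt1 prim_z).
have := valuation_prime hv; rewrite -(prod_1B_prim_root prim_z) (valuation_prod hv).
have v_factor i : (1 <= i < p)%N -> v (1 - z ^+ i) = r%:E.
  move=> /andP[i_gt0 lt_ip]; rewrite (valuation_1B_prim_root_exp hv prim_z) //.
  by rewrite coprime_sym prime_coprime ?(padic_prime hv) // gtnNdvd.
rewrite (eq_big_nat _ _ v_factor) sumEFin sumr_const_nat subn1 vz => -[] rp1.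
have predp_neq0 : p.-1%:R != 0 :> R by rewrite pnatr_eq0 -lt0n -subn1 subn_gt0.
by congr EFin; apply: (mulIf predp_neq0); rewrite mulr_natr rp1 mulVf.
Qed.

Lemma valuation_horner_1B_prim_root (F0 : [pchar F] =i pred0) (z : F) (P : {poly rat}) :
  p.-primitive_root z -> (size P <= p.-1)%N ->
  v (map_poly (ratr_pchar0 F0) P).[1 - z] =
    \big[Order.min/+oo%E]_(i < p.-1) (v (ratr P`_i) + (i%:R / p.-1%:R)%:E)%E.
Proof.
move=> prim_z size_P; transitivity (\big[Order.min/+oo%E]_(i < p.-1)
    (v (map_poly (ratr_pchar0 F0) P)`_i + (i%:R / p.-1%:R)%:E)%E).
  apply: (valuation_horner_invn hv); rewrite ?size_map_poly //.
  - by rewrite -subn1 subn_gt0 (prime_gt1 (padic_prime hv)).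
  - exact: valuation_1B_prim_root.
  by move=> i; rewrite coef_map fmorph_eq0 => /(valuation_rat hv).
by apply: eq_bigr => i _; rewrite coef_map.
Qed.

Lemma valuation_horner_prim_root (F0 : [pchar F] =i pred0) (z z' : F) (P : {poly rat}) :
  p.-primitive_root z -> p.-primitive_root z' ->
  v (map_poly (ratr_pchar0 F0) P).[z] = v (map_poly (ratr_pchar0 F0) P).[z'].
Proof.
have p_gt1 := prime_gt1 (padic_prime hv).
pose Phi : {poly rat} := \poly_(i < p) 1.
pose Q := (P %% Phi) \Po (1 - 'X).
have size_Phi : size Phi = p by rewrite size_poly_eq ?oner_eq0.
have size_Q : (size Q <= p.-1)%N.
  rewrite size_comp_poly2; last by rewrite -opprB size_polyN -polyC1 size_XsubC.
  rewrite -ltnS prednK ?(ltnW p_gt1) // -[X in (_ < X)%N]size_Phi.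
  by rewrite ltn_modp -size_poly_gt0 size_Phi ltnW.
have horner_Q (y : F) : p.-primitive_root y ->
    (map_poly (ratr_pchar0 F0) P).[y] = (map_poly (ratr_pchar0 F0) Q).[1 - y].
  move=> prim_y; rewrite (horner_modp_prim_root _ _ p_gt1 prim_y).
  by rewrite map_comp_poly horner_comp rmorphB rmorph1 /= map_polyX !hornerE subKr.
move=> prim_z prim_z'; rewrite !horner_Q //.
by rewrite !(valuation_horner_1B_prim_root _ _ size_Q).
Qed.

End PrimitiveRootValuation.

Section RatConjugate.
Context (F : fieldType) (F0 : [pchar F] =i pred0) (z z' : F).
Local Notation iota := (ratr_pchar0 F0).

Definition rat_conjugate (x y : F) : Prop :=
  exists P : {poly rat}, x = (map_poly iota P).[z] /\ y = (map_poly iota P).[z'].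

Lemma rat_conjugate_ratr r : rat_conjugate (iota r) (iota r).
Proof. by exists r%:P; rewrite map_polyC !hornerC. Qed.

Lemma rat_conjugate_nat n : rat_conjugate n%:R n%:R.
Proof. by rewrite -(rmorph_nat iota); apply: rat_conjugate_ratr. Qed.

Lemma rat_conjugate_natV n : rat_conjugate n%:R^-1 n%:R^-1.
Proof. by rewrite -(rmorph_nat iota) -fmorphV; apply: rat_conjugate_ratr. Qed.

Lemma rat_conjugate_exp n : rat_conjugate (z ^+ n) (z' ^+ n).
Proof. by exists 'X^n; rewrite map_polyXn !hornerXn. Qed.

Lemma rat_conjugateD x y x' y' :
  rat_conjugate x y -> rat_conjugate x' y' -> rat_conjugate (x + x') (y + y').
Proof.
by move=> [P [-> ->]] [Q [-> ->]]; exists (P + Q); rewrite rmorphD !hornerD.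
Qed.

Lemma rat_conjugateM x y x' y' :
  rat_conjugate x y -> rat_conjugate x' y' -> rat_conjugate (x * x') (y * y').
Proof.
by move=> [P [-> ->]] [Q [-> ->]]; exists (P * Q); rewrite rmorphM !hornerM.
Qed.

Lemma rat_conjugate_sum (I : Type) (r : seq I) (P : pred I) (f g : I -> F) :
  (forall i, P i -> rat_conjugate (f i) (g i)) ->
  rat_conjugate (\sum_(i <- r | P i) f i) (\sum_(i <- r | P i) g i).
Proof.
move=> conj_fg; elim/big_ind2: _ => //; first exact: (rat_conjugate_nat 0).
by move=> x y x' y'; apply: rat_conjugateD.
Qed.

Lemma rat_conjugate_coefX (A B : {poly F}) n i :
  (forall j, rat_conjugate A`_j B`_j) -> rat_conjugate (A ^+ n)`_i (B ^+ n)`_i.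
Proof.
move=> conj_AB; elim: n i => [|n IHn] i.
  by rewrite !expr0 !coef1; apply: rat_conjugate_nat.
by rewrite !exprS !coefM; apply: rat_conjugate_sum => j _; apply: rat_conjugateM.
Qed.

End RatConjugate.

Lemma rat_conjugate_exp_coef (C : closedFieldType) (C0 : [pchar C] =i pred0)
    (z z' : C) (S T : nat -> C) n :
  (forall k, rat_conjugate C0 z z' (S k) (T k)) ->
  rat_conjugate C0 z z' (exp_coef S n) (exp_coef T n).
Proof.
move=> conj_ST; rewrite /exp_coef !coef_sum; apply: rat_conjugate_sum => j _.
rewrite !coefZ; apply: rat_conjugateM; first exact: rat_conjugate_natV.
apply: rat_conjugate_coefX => i; rewrite !coef_sum.
apply: rat_conjugate_sum => k _; rewrite !coefZ !coefXn.
apply: rat_conjugateM; last exact: rat_conjugate_nat.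
exact/rat_conjugateM/rat_conjugate_natV.
Qed.

Lemma valuation_rat_conjugate (R : realFieldType) (F : fieldType) (v : F -> \bar R)
    (p : nat) (hv : is_padic_valuation v p) (F0 : [pchar F] =i pred0) (z z' x y : F) :
  p.-primitive_root z -> p.-primitive_root z' -> rat_conjugate F0 z z' x y ->
  v x = v y.
Proof.
by move=> prim_z prim_z' [P [-> ->]]; apply: (valuation_horner_prim_root hv).
Qed.

(** * p-adic numbers *)

Section PadicNumbers.
Context (R : realType) (C : closedFieldType) (ord : C -> \bar R) (p : nat).
Context (hv : is_padic_valuation ord p).
Local Notation iota := (ratr_pchar0 (padic_pchar0 hv)).

Lemma Qp_ratr r : Qp ord (ratr r).
Proof. by move=> M; exists r; rewrite subrr (valuation0 hv) leey. Qed.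

Lemma Qp_nat n : Qp ord n%:R.
Proof. by rewrite -(ratr_nat C); apply: Qp_ratr. Qed.

Lemma QpD x y : Qp ord x -> Qp ord y -> Qp ord (x + y).
Proof.
move=> Qx Qy M; have [[r xr] [s ys]] := (Qx M, Qy M); exists (r + s).
by rewrite (rmorphD iota) opprD addrACA (valuation_geD hv).
Qed.

Lemma QpM x y : Qp ord x -> Qp ord y -> Qp ord (x * y).
Proof.
move=> Qx Qy M; have [Nx mulx_ge] := valuation_mul_ge hv x M; have [s ys] := Qy Nx.
have [Ns muls_ge] := valuation_mul_ge hv (ratr s) M; have [r xr] := Qx Ns.
exists (r * s).
have -> : x * y - ratr (r * s) = x * (y - ratr s) + ratr s * (x - ratr r).
  by rewrite (rmorphM iota) /= /ratr_pchar0; ring.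
by apply: (valuation_geD hv); [apply: mulx_ge|apply: muls_ge].
Qed.

Lemma QpB x y : Qp ord x -> Qp ord y -> Qp ord (x - y).
Proof.
move=> Qx Qy; rewrite -mulN1r; apply: QpD => //; apply: QpM => //.
by rewrite -(rmorphN1 iota); apply: Qp_ratr.
Qed.

Lemma QpV x : Qp ord x -> Qp ord x^-1.
Proof.
move=> Qx M; have [->|x_neq0] := eqVneq x 0.
  by exists 0; rewrite invr0 (rmorph0 iota) subrr (valuation0 hv) leey.
have [a ord_x] := valuation_EFin hv x_neq0.
have [r xr] := Qx (Order.max (M + a *+ 2) (a + 1)).
have xr_ge : ((M + a *+ 2)%:E <= ord (x - ratr r)%R)%E.
  by apply: le_trans xr; rewrite lee_fin le_max lexx.
have rx_gt : (ord x < ord (ratr r - x)%R)%E.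
  rewrite ord_x (valuation_distC hv); apply: lt_le_trans xr.
  by rewrite lte_fin lt_max ltrDl ltr01 orbT.
have ord_r : ord (ratr r) = a%:E by rewrite -(subrKC x (ratr r)) (valuationD_lt hv).
have r_neq0 : ratr r != 0 :> C.
  by apply: contra_eq_neq ord_r => ->; rewrite (valuation0 hv).
exists r^-1; rewrite (fmorphV iota) /= /ratr_pchar0.
have -> : x^-1 - (ratr r)^-1 = (ratr r - x) * (x * ratr r)^-1.
  by field; rewrite x_neq0 r_neq0.
rewrite (valuationM hv) (valuationV hv (mulf_neq0 x_neq0 r_neq0)).
by rewrite (valuationM hv x) ord_x ord_r (valuation_distC hv) leeBrDr.
Qed.

Lemma Qp_sum (I : Type) (r : seq I) (P : pred I) (f : I -> C) :
  (forall i, P i -> Qp ord (f i)) -> Qp ord (\sum_(i <- r | P i) f i).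
Proof. by move=> Qf; elim/big_ind: _ => //; [exact: (Qp_nat 0)|exact: QpD]. Qed.

Definition Zp_teich (l : nat) : set C :=
  [set w | [/\ Qp ord w, w ^+ p = w & vcongr ord 1%:E w l%:R]].

Lemma Zp_teich_ge0 l w : Zp_teich l w -> (0 <= ord w)%E.
Proof.
move=> [_ _ wl]; apply: (vcongr_ge hv _ wl (valuation_natr_ge0 hv l)).
by rewrite lee_fin ler01.
Qed.

End PadicNumbers.

Lemma lee_truncnS (R : archiRealFieldType) (M : R) :
  (M%:E <= (Num.truncn M).+1%:R%:E)%E.
Proof. by rewrite lee_fin ltW // truncnS_gt. Qed.

Section Completeness.
Context (R : realType) (C : closedFieldType) (ord : C -> \bar R) (p : nat).
Context (hp : prime p) (hC : is_Cp ord p).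

Lemma Cp_padic_valuation : is_padic_valuation ord p.
Proof. by case: hC. Qed.
Local Notation hv := Cp_padic_valuation.

Lemma Cp_vcongr_lim (u : nat -> C) :
  (forall n, vcongr ord n%:R%:E (u n) (u n.+1)) ->
  exists l, forall n, vcongr ord n%:R%:E (u n) l.
Proof.
move=> u_step; have u_le m n : (m <= n)%N -> vcongr ord m%:R%:E (u m) (u n).
  elim: n => [|n IHn]; first by rewrite leqn0 => /eqP ->; exact: (vcongr_refl hv).
  rewrite leq_eqVlt => /predU1P[->|le_mn]; first exact: (vcongr_refl hv).
  apply: (vcongr_trans hv (IHn le_mn)); apply: vcongr_le (u_step n).
  by rewrite lee_fin ler_nat.
have [M|l u_l] := @Cp_complete _ _ _ _ hC u.
  exists (Num.truncn M).+1 => m n le_m le_n; apply: le_trans (lee_truncnS M) _.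
  by apply: (vcongr_trans hv _ (u_le _ _ le_n)); rewrite (vcongrC hv) u_le.
exists l => n; have [N ul_ge] := u_l n%:R.
apply: (vcongr_trans hv (u_le n (maxn n N) (leq_maxl _ _))).
exact/ul_ge/leq_maxr.
Qed.

(* The Teichmuller lift of [l] is the limit of [l ^ p ^ n].                   *)
Lemma Zp_teich_exists l : exists w, Zp_teich ord p l w.
Proof.
pose u n : C := (l ^ p ^ n)%:R.
have uS n : u n.+1 = u n ^+ p by rewrite /u expnSr expnM natrX.
have u_ge0 n : (0 <= ord (u n))%E by exact: (valuation_natr_ge0 hv).
have u1 : vcongr ord 1%:E (u 1%N) l%:R.
  by rewrite -[1%:E]/(1%:R%:E) (vcongr_nat hv) !expn1 fermat_little.
have u_step n : vcongr ord n%:R%:E (u n) (u n.+1).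
  have u1X : u n.+1 = u 1%N ^+ (p ^ n) by rewrite /u expnS expnM natrX expn1.
  have lX : u n = l%:R ^+ (p ^ n) by rewrite /u natrX.
  rewrite (vcongrC hv) /vcongr u1X lX.
  apply: le_trans (valuation_subXpn_ge hv n _ _ lee01 (lexx _) u1) => //; last first.
    exact: (valuation_natr_ge0 hv).
  by rewrite -EFin_natmul leeDr // (le_trans lee01 u1).
have [w u_w] := Cp_vcongr_lim u_step.
have w_u n : vcongr ord n%:R%:E w (u n) by rewrite (vcongrC hv).
have w_ge0 : (0 <= ord w)%E := vcongr_ge hv (lexx _) (w_u 0%N) (u_ge0 0%N).
exists w; split; last exact: (vcongr_trans hv (w_u 1%N) u1).
  move=> M; exists (l ^ p ^ (Num.truncn M).+1)%:R; rewrite ratr_nat.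
  exact: (le_trans (lee_truncnS M) (w_u _)).
apply/eqP; rewrite -subr_eq0; apply/eqP/(valuation_ge_eq0 hv) => M.
apply: le_trans (lee_truncnS M) _; set n := (Num.truncn M).+1.
apply: (vcongr_trans hv (y := u n.+1)); first by rewrite uS; apply: (vcongrX hv).
by apply: vcongr_le (u_w n.+1); rewrite lee_fin ler_nat.
Qed.

End Completeness.

(** * Unramified extensions *)

Lemma xget0_mull (F : fieldType) (w : F) (A B : set F) :
  w != 0 -> is_subset1 B -> (forall t, A t <-> B (w * t)) ->
  xget 0 B = w * xget 0 A.
Proof.
move=> w_neq0 subset1_B AB; case: (xgetP 0 A) => [t _ /AB Bwt|noA].
  exact: xget_subset1.
rewrite mulr0; apply: xgetPN => t Bt; apply: (noA (w^-1 * t)).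
by apply/AB; rewrite mulVKf.
Qed.

Section Unramified.
Context (R : realType) (C : closedFieldType) (ord : C -> \bar R) (p : nat).
Context (hv : is_padic_valuation ord p) (E : unram_ext ord p).
Local Notation K := (ucarrier E).
Local Notation OK := (integers ord K).

Lemma ucarrier0 : K 0.
Proof. by have [K1 KB _] := ucarrier_subfield E; rewrite -(subrr 1); apply: KB. Qed.

Lemma ucarrierV x : K x -> K x^-1.
Proof. by have [K1 _ Kdiv] := ucarrier_subfield E; rewrite -div1r; apply: Kdiv. Qed.

Lemma ucarrierM x y : K x -> K y -> K (x * y).
Proof.
have [_ _ Kdiv] := ucarrier_subfield E.
by move=> Kx Ky; rewrite -[y]invrK; apply/Kdiv/ucarrierV.
Qed.

Lemma integersM x y : OK x -> OK y -> OK (x * y).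
Proof.
by move=> [? ?] [? ?]; split; [exact: ucarrierM|exact: (valuation_geMl hv)].
Qed.

Lemma integersB x y : OK x -> OK y -> OK (x - y).
Proof.
have [_ KB _] := ucarrier_subfield E.
by move=> [? ?] [? ?]; split; [exact: KB|exact: (valuation_geB hv)].
Qed.

Lemma integers_nat n : OK n%:R.
Proof. by split; [exact/ucarrier_Qp/(Qp_nat hv)|exact: (valuation_natr_ge0 hv)]. Qed.

Lemma ured0 : ured E 0 = 0.
Proof. by apply/(ured_ker (integers_nat 0)); rewrite (valuation0 hv) lt0y. Qed.

Lemma ured_nat n : ured E n%:R = n%:R.
Proof.
elim: n => [|n IHn]; first exact: ured0.
by rewrite -!natr1 uredD ?IHn ?ured1 //; [exact: integers_nat|exact: (integers_nat 1)].
Qed.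

Lemma ures_natr_neq0 n : coprime n p -> n%:R != 0 :> ures E.
Proof.
move=> co_np; rewrite -ured_nat; apply/eqP => /(ured_ker (integers_nat n)).
by rewrite (valuation_coprime hv co_np) ltxx.
Qed.

Lemma ured_eq x y : OK x -> OK y -> (ured E x = ured E y <-> (0 < ord (x - y)%R)%E).
Proof.
move=> OKx OKy; have OKxy := integersB OKx OKy; rewrite -(ured_ker OKxy).
have -> : ured E x = ured E (x - y) + ured E y by rewrite -uredD // subrK.
by split=> [/eqP|->]; rewrite ?add0r // -subr_eq0 addrK => /eqP.
Qed.

Lemma udeg_gt0 : (0 < udeg E)%N.
Proof.
by have := card_finNzRing_gt1 (ures E); rewrite uunram lt0n; case: (udeg E).
Qed.

Definition is_teich (b : ures E) : set C :=
  [set t | [/\ OK t, ured E t = b & t ^+ #|ures E| = t]].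

(* Raising to the power [#|ures E|] fixes both lifts, yet increases [ord (x - y)]. *)
Lemma is_teich_subset1 b : is_subset1 (is_teich b).
Proof.
move=> x y [[? x_ge0] xb xq] [[? y_ge0] yb yq].
have xy_gt0 : (0 < ord (x - y)%R)%E by apply/ured_eq; rewrite ?xb.
apply/eqP; rewrite -subr_eq0; apply/negPn/negP => /(valuation_EFin hv) [r ord_xy].
pose m := Order.min 1 r.
have m_gt0 : 0 < m by rewrite lt_min ltr01 -lte_fin -ord_xy.
have := @valuation_subXpn_ge _ _ _ _ hv m%:E x y (udeg E) x_ge0 y_ge0.
rewrite /vcongr -uunram xq yq ord_xy !lee_fin (ltW m_gt0) !ge_min !lexx orbT.
move=> /(_ isT isT isT); rewrite -EFin_natmul -EFinD lee_fin gerDl.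
by rewrite leNgt pmulrn_rgt0 ?m_gt0 // udeg_gt0.
Qed.

Lemma is_teich0 : is_teich 0 0.
Proof.
split; [exact: (integers_nat 0)|exact: ured0|].
by rewrite expr0n gtn_eqF // ltnW ?card_finNzRing_gt1.
Qed.

Lemma is_teich_eq0 b t : is_teich b t -> (b == 0) = (t == 0).
Proof.
move=> tb; apply/eqP/eqP => [b0|t0].
  by apply: is_teich_subset1 is_teich0; rewrite -b0.
by case: tb => _ <- _; rewrite t0 ured0.
Qed.

Lemma is_teichM b c t u : is_teich b t -> is_teich c u -> is_teich (b * c) (t * u).
Proof.
move=> [OKt <- tq] [OKu <- uq]; split; first exact: integersM.
  by rewrite uredM.
by rewrite exprMn tq uq.
Qed.

Lemma is_teichV b t : is_teich b t -> is_teich b^-1 t^-1.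
Proof.
move=> tb; have := is_teich_eq0 tb; have [t0|t_neq0] := eqVneq t 0.
  by move/eqP => ->; rewrite t0 !invr0; apply: is_teich0.
move=> b_neq0; case: (tb) => -[Kt t_ge0] bt tq.
have ord_t : ord t = 0%E.
  apply: (valuation_expr_eq1 hv (n := #|ures E|.-1)).
    by rewrite -subn1 subn_gt0 card_finNzRing_gt1.
  by apply: (mulfI t_neq0); rewrite -exprS prednK ?mulr1 // ltnW ?card_finNzRing_gt1.
have OKV : OK t^-1.
  by split; [exact: ucarrierV|rewrite (valuationV hv t_neq0) ord_t oppe0].
split => //; last by rewrite exprVn tq.
apply: (mulfI (negbT b_neq0)); rewrite mulfV ?b_neq0 //.
by rewrite -bt -uredM // mulfV // ured1.
Qed.

Lemma is_teich_Zp l w : Zp_teich ord p l w -> is_teich l%:R w.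
Proof.
move=> w_lift; have OKw : OK w.
  by split; [case: w_lift => /ucarrier_Qp|exact: (Zp_teich_ge0 hv w_lift)].
case: w_lift => _ wp wl; split=> //.
  rewrite -ured_nat; apply/(ured_eq OKw (integers_nat l)).
  by apply: lt_le_trans wl; rewrite lte_fin ltr01.
rewrite uunram; elim: (udeg E) => [|n IHn]; first by rewrite expr1.
by rewrite expnS exprM wp.
Qed.

Lemma teich_eq (b : ures E) t : is_teich b t -> teich b = t.
Proof. by move=> /xget_subset1; apply; apply: is_teich_subset1. Qed.

Lemma teich0 : teich (0 : ures E) = 0.
Proof. exact/teich_eq/is_teich0. Qed.

Lemma teich_mull (b c : ures E) t : is_teich b t -> teich (b * c) = t * teich c.
Proof.
move=> tb; have [t0|t_neq0] := eqVneq t 0.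
  move: (is_teich_eq0 tb); rewrite t0 eqxx => /eqP ->.
  by rewrite !mul0r teich0.
apply: (xget0_mull t_neq0) => [|u]; first exact: is_teich_subset1.
split; first exact: (is_teichM tb).
move/(is_teichM (is_teichV tb)); rewrite !mulKf //.
by rewrite (is_teich_eq0 tb).
Qed.

Lemma teich_polyZ (b : ures E) t (g : {poly ures E}) :
  is_teich b t -> teich_poly (b *: g) = t *: teich_poly g.
Proof.
move=> tb; apply/polyP => i.
by rewrite coefZ !coef_map_id0 ?teich0 // coefZ (teich_mull _ tb).
Qed.

End Unramified.

Section Trace.
Context (R : realType) (C : closedFieldType) (ord : C -> \bar R) (p : nat).
Context (hv : is_padic_valuation ord p) (K : set C) (K0 : K 0).

Definition Qp_mx m n (A : 'M[C]_(m, n)) : Prop := forall i j, Qp ord (A i j).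

Lemma Qp_mxM m n k (A : 'M[C]_(m, n)) (B : 'M[C]_(n, k)) :
  Qp_mx A -> Qp_mx B -> Qp_mx (A *m B).
Proof.
move=> QA QB i j; rewrite mxE; apply: (Qp_sum hv) => l _.
exact: (QpM hv).
Qed.

Lemma Qp_mx1 n : Qp_mx (1%:M : 'M[C]_n).
Proof. by move=> i j; rewrite mxE; apply: (Qp_nat hv). Qed.

Lemma Qp_basis_mulmx_inj n (e : 'rV[C]_n) k (A B : 'M[C]_(n, k)) :
  is_Qp_basis ord K e -> Qp_mx A -> Qp_mx B -> e *m A = e *m B -> A = B.
Proof.
move=> basis_e QA QB eAB; have [c [_ c_uniq]] := (basis_e 0).1 K0.
have c0 : c = 0.
  apply: c_uniq; split=> [l|]; first by rewrite mxE; apply: (Qp_nat hv 0).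
  by rewrite mulmx0 mxE.
apply/matrixP => i j; apply/eqP; rewrite -subr_eq0.
have -> : A i j - B i j = (col j A - col j B) i 0 by rewrite !mxE.
rewrite -(c_uniq (col j A - col j B)); first by rewrite c0 mxE.
split=> [l|]; first by rewrite !mxE; apply: (QpB hv).
by rewrite mulmxBr !colE !mulmxA eAB subrr mxE.
Qed.

Lemma Qp_basis_mem n (e : 'rV[C]_n) k (A : 'M[C]_(n, k)) j :
  is_Qp_basis ord K e -> Qp_mx A -> K ((e *m A) 0 j).
Proof.
move=> basis_e QA; apply/(basis_e _).
have eAj : (e *m A) 0 j = (e *m col j A) 0 0.
  by rewrite !mxE; apply: eq_bigr => i _; rewrite !mxE.
exists (col j A); split=> [|c [Qc eAc]]; first by split=> [i|//]; rewrite mxE.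
apply: (Qp_basis_mulmx_inj basis_e) => [i l|i l|]; rewrite ?mxE ?ord1 //.
by apply/matrixP => i l; rewrite !ord1 -eAj eAc.
Qed.

Lemma Qp_basis_change n n' (e : 'rV[C]_n) (e' : 'rV[C]_n') :
  is_Qp_basis ord K e -> is_Qp_basis ord K e' ->
  exists2 A : 'M[C]_(n, n'), Qp_mx A & e' = e *m A.
Proof.
move=> basis_e basis_e'.
have /choice [f f_coord] j : exists c : 'cV[C]_n,
    (forall i, Qp ord (c i 0)) /\ e' 0 j = (e *m c) 0 0.
  have := Qp_basis_mem j basis_e' (@Qp_mx1 n').
  by rewrite mulmx1 => /(basis_e _) [c [c_coord _]]; exists c.
exists (\matrix_(i, j) f j i 0) => [i j|].
  by rewrite mxE; apply: (f_coord j).1.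
apply/matrixP => i j; rewrite ord1 (f_coord j).2 !mxE.
by apply: eq_bigr => s _; rewrite mxE.
Qed.

Definition is_trace (x : C) : set C :=
  [set t | exists (n : nat) (e : 'rV[C]_n) (M : 'M[C]_n),
    [/\ is_Qp_basis ord K e, Qp_mx M, x *: e = e *m M & t = \tr M]].

(* The change-of-basis matrices satisfy [M' = B M A] with [A B = 1], and the  *)
(* cyclicity of the trace does not require the two bases to have equal size.  *)
Lemma is_trace_subset1 x : is_subset1 (is_trace x).
Proof.
move=> _ _ [n [e [M [basis_e QM eM ->]]]] [n' [e' [M' [basis_e' QM' eM' ->]]]].
have [A QA eA] := Qp_basis_change basis_e basis_e'.
have [B QB eB] := Qp_basis_change basis_e' basis_e.
have AB : A *m B = 1%:M.
  apply: (Qp_basis_mulmx_inj basis_e _ (@Qp_mx1 _)); first exact: Qp_mxM.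
  by rewrite mulmxA -eA -eB mulmx1.
have BA : B *m A = 1%:M.
  apply: (Qp_basis_mulmx_inj basis_e' _ (@Qp_mx1 _)); first exact: Qp_mxM.
  by rewrite mulmxA -eB -eA mulmx1.
have AM : A *m M' = M *m A.
  apply: (Qp_basis_mulmx_inj basis_e); try exact: Qp_mxM.
  by rewrite !mulmxA -eA -eM' -eM -scalemxAl -eA.
by rewrite -[M']mul1mx -BA -mulmxA AM mxtrace_mulC -mulmxA AB mulmx1.
Qed.

Lemma is_traceZ w x t : Qp ord w -> is_trace x t -> is_trace (w * x) (w * t).
Proof.
move=> Qw [n [e [M [basis_e QM eM ->]]]]; exists n, e, (w *: M); split=> //.
- by move=> i j; rewrite mxE; apply: (QpM hv).
- by rewrite -scalerA eM scalemxAr.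
by rewrite mxtraceZ.
Qed.

Lemma trace_QpZ w x : Qp ord w -> trace_Qp ord K (w * x) = w * trace_Qp ord K x.
Proof.
move=> Qw; have [->|w_neq0] := eqVneq w 0.
  rewrite !mul0r /trace_Qp -/(is_trace 0); case: xgetP => // t _ tr0.
  by apply: (is_trace_subset1 tr0); have := is_traceZ (Qp_nat hv 0) tr0; rewrite !mul0r.
apply: (xget0_mull w_neq0) => [|t]; first exact: is_trace_subset1.
split; first exact: is_traceZ.
by move/(is_traceZ (QpV hv Qw)); rewrite !mulKf.
Qed.

End Trace.

(** * Newton polygons *)

Section NewtonPolygon.
Context (R : realType) (C : closedFieldType) (ord : C -> \bar R) (p : nat).
Context (hv : is_padic_valuation ord p).

Lemma padic_powMl (zeta : C) l w z : zeta ^+ p = 1 -> coprime l p ->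
  vcongr ord 1%:E w l%:R -> padic_pow ord zeta (w * z) = padic_pow ord (zeta ^+ l) z.
Proof.
move=> zeta_p co_lp wl; have ord_w := vcongr_coprime hv co_lp wl.
have ord_nat n : (0 <= ord n%:R)%E := valuation_natr_ge0 hv n.
pose residue (y : C) : set nat := [set n | vcongr ord 1%:E y n%:R]%classic.
have residue_mulw y n : residue y n -> residue (w * y) (l * n)%N.
  rewrite /residue /= natrM => yn.
  by apply: (vcongrM hv); rewrite ?ord_w.
have residue_modn y m n : residue y m -> residue y n -> m = n %[mod p].
  rewrite /residue /= (vcongrC hv) => my yn; apply/eqP.
  by rewrite -[p]expn1 -(vcongr_nat hv) (vcongr_trans hv my yn).
rewrite /padic_pow -!/(residue _).
case: (xgetP 0%N (residue z)) => [n _ zn|no_residue].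
  rewrite -exprM -(expr_mod _ zeta_p) -[RHS](expr_mod _ zeta_p); congr (_ ^+ _).
  by apply: residue_modn (residue_mulw _ _ zn); apply: xgetI (residue_mulw _ _ zn).
rewrite xgetPN // => n wzn.
have /dvdnP [k lk] : (l %| chinese l p 0 n)%N by rewrite /dvdn chinese_modl ?mod0n.
have lk_n : vcongr ord 1%:E n%:R (l * k)%:R.
  by rewrite -[1%:E]/(1%:R%:E) (vcongr_nat hv) expn1 mulnC -lk chinese_modr.
apply: (no_residue k); rewrite /residue /= -(vcongr_mul2l hv _ _ _ ord_w).
apply: (vcongr_trans hv (vcongr_trans hv wzn lk_n)).
by rewrite (vcongrC hv); apply/residue_mulw/(vcongr_refl hv).
Qed.

Context (E : nat -> unram_ext ord p).

Lemma NP_eq zeta zeta' (f g : {poly ures (E 1%N)}) : size f = size g ->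
  (forall n, ord (Lcoef zeta f n) = ord (Lcoef zeta' g n)) ->
  NP zeta f = NP zeta' g.
Proof.
move=> size_fg ord_fg; rewrite /NP size_fg; congr lower_convex_hull.
by apply/seteqP; split=> P [n [n_le Pn ordPn]]; exists n; rewrite ?ord_fg // -ord_fg.
Qed.

Lemma NP_prim_root zeta zeta' (f : {poly ures (E 1%N)}) :
  p.-primitive_root zeta -> p.-primitive_root zeta' -> NP zeta f = NP zeta' f.
Proof.
move=> prim_zeta prim_zeta'; apply: NP_eq => // n.
apply: (valuation_rat_conjugate hv (F0 := padic_pchar0 hv) prim_zeta prim_zeta').
apply: rat_conjugate_exp_coef => k; apply: rat_conjugate_sum => b _.
exact: rat_conjugate_exp.
Qed.

Context (hC : is_Cp ord p).

Lemma expsum_scale zeta (g : {poly ures (E 1%N)}) l k :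
  zeta ^+ p = 1 -> coprime l p ->
  expsum zeta (l%:R *: g) k = expsum (zeta ^+ l) g k.
Proof.
move=> zeta_p co_lp; have [w w_lift] := Zp_teich_exists (padic_prime hv) hC l.
have [Qw _ wl] := w_lift; apply: eq_bigr => b _.
rewrite (teich_polyZ hv _ (is_teich_Zp hv (E 1%N) w_lift)) hornerZ.
by rewrite (trace_QpZ hv (ucarrier0 (E k))) // (padic_powMl _ zeta_p co_lp wl).
Qed.

Lemma NP_scale zeta (f : {poly ures (E 1%N)}) l :
  zeta ^+ p = 1 -> coprime l p -> NP zeta (l%:R *: f) = NP (zeta ^+ l) f.
Proof.
move=> zeta_p co_lp; apply: NP_eq => [|n].
  by rewrite size_scale // (ures_natr_neq0 hv).
by congr (ord (exp_coef _ n)); apply/funext => k; apply: expsum_scale.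
Qed.

End NewtonPolygon.

Theorem theorem1p2 (R : realType) (p a : nat) (hp : prime p) (ha : (1 <= a)%N)
    (C : closedFieldType) (ord : C -> \bar R) (hC : is_Cp ord p)
    (zeta : C) (hzeta : p.-primitive_root zeta)
    (E : nat -> unram_ext ord p)
    (hE : forall k, (1 <= k)%N -> udeg (E k) = (a * k)%N)
    (d : nat) (f : {poly ures (E 1%N)}) (hf : size f = d.+1)
    (hd : coprime d p)
    (lambda : 'F_p) (hlambda : lambda != 0) :
  NP zeta f = NP zeta ((nat_of_ord lambda)%:R *: f).
Proof.
have co_lambda : coprime lambda p.
  rewrite coprime_sym prime_coprime // gtnNdvd ?lt0n //.
  by rewrite -[X in (_ < X)%N](Fp_cast hp) ltn_ord.
have hv := Cp_padic_valuation hp hC.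
rewrite (NP_scale hv hC f (prim_expr_order hzeta) co_lambda).
by apply: (NP_prim_root hv); rewrite ?prim_root_exp_coprime.
Qed.
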